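(* Let $A$ be a Noetherian complete local $\mathbb K$-algebra with residue field $\mathbb K$, let $\phi_0\in\mathfrak L_m(\mathbb K)$ and let $\mathcal A\subset\mathcal I$ be an admissible set at $\phi_0$. For every deformation $\phi'\in\mathrm{Def}(\phi_0,A)$ of $\phi_0$ there exists an element $\phi$ of the orbit $[\phi']$ under $\mathrm G_m(A)$ such that $\phi^\alpha=(\phi_0)^\alpha$ for all $\alpha\in\mathcal A$.
   Context: $\mathbb K$ is an algebraically closed field of characteristic $0$. $\mathfrak L_m(A)$ is the set of Lie $A$-algebra multiplications on $A\otimes\mathbb K^m$. For a local $\mathbb K$-algebra $A$ with maximal ideal $\mathfrak m$ and residue field $\mathbb K$, $\mathrm{Def}(\phi_0,A)$ is the set of $\phi\in\mathfrak L_m(A)$ that reduce to $\phi_0$ modulo $\mathfrak m$. The group $\mathrm G_m(A)=\mathrm{id}+\mathrm M_m(\mathfrak m)$ acts by $s*\phi=s\circ\phi\circ(s^{-1}\times s^{-1})$. Let $\mathfrak g=(\mathbb K^m,\phi_0)$ and fix a basis $(e_\alpha)_{\alpha\in\mathcal I}$ of $\mathrm C^2(\mathfrak g,\mathfrak g)=\mathrm{Hom}(\wedge^2\mathfrak g,\mathfrak g)$; write $\phi=\sum_\alpha\phi^\alpha e_\alpha$ (for instance the $\phi^\alpha$ are the structure constants $\phi^k_{ij}$, $i<j$). A subset $\mathcal A\subset\mathcal I$ is admissible at $\phi_0$ if it is minimal such that the linear forms $L\mapsto(dL)^\alpha$, $\alpha\in\mathcal A$, on $\mathrm C^1(\mathfrak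 g,\mathfrak g)$ ($d$ the Chevalley–Eilenberg differential with adjoint coefficients) have maximal rank $\dim\mathrm B^2(\mathfrak g,\mathfrak g)$; equivalently $(e_\alpha)_{\alpha\notin\mathcal A}$ spans a complement of the 2-coboundaries $\mathrm B^2(\mathfrak g,\mathfrak g)$. *)

(* Defs.v *)
From HB Require Import structures.
From mathcomp Require Import all_boot all_order all_algebra.

Set Implicit Arguments.
Unset Strict Implicit.
Unset Printing Implicit Defensive.

Import GRing.Theory.
Local Open Scope ring_scope.

Section Ideals.
Variable R : comNzRingType.
Implicit Types I J : R -> Prop.

Definition is_ideal I : Prop :=
  [/\ I 0, forall x y, I x -> I y -> I (x + y)
         & forall a x, I x -> I (a * x)].

Definition is_maximal_ideal I : Prop :=
  [/\ is_ideal I, ~ I 1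
    & forall J, is_ideal J -> ~ J 1 ->
        (forall x, I x -> J x) -> forall x, J x -> I x].

Definition is_local I : Prop :=
  is_maximal_ideal I /\
  forall J, is_maximal_ideal J -> forall x, J x <-> I x.

Definition is_noetherian : Prop :=
  forall I, is_ideal I ->
    exists s : seq R, forall x,
      I x <-> exists c : 'I_(size s) -> R, x = \sum_i c i * s`_i.

Definition ideal_mul I J : R -> Prop := fun x =>
  exists s : seq (R * R),
    (forall p, p \in s -> I p.1 /\ J p.2) /\ x = \sum_(p <- s) p.1 * p.2.

Fixpoint ideal_exp I (n : nat) : R -> Prop :=
  if n is n'.+1 then ideal_mul I (ideal_exp I n') else fun _ => True.

(* R -> lim_n R / I ^ n is bijective; in particular "complete" includes
   "separated". *)
Definition adically_complete I : Prop :=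
  forall u : nat -> R, (forall n, ideal_exp I n (u n.+1 - u n)) ->
    exists! a : R, forall n, ideal_exp I n (a - u n).

End Ideals.

(* The structural map K -> A / I is bijective. *)
Definition residue_field_is_base (K : fieldType) (A : comAlgType K)
    (I : A -> Prop) : Prop :=
  forall a : A, exists! c : K, I (a - c%:A).

(* R-bilinear maps R^m x R^m -> R^m; an element f is applied as f x y. *)
Notation bilin R m := 'Hom('cV[R]_m, 'Hom('cV[R]_m, 'cV[R]_m)).

(* linfun f is meaningful only for linear f, so mkbilin f is meaningful only
   for bilinear f: see mkbilinE. *)
Definition mkbilin (R : comNzRingType) (m : nat)
    (f : 'cV[R]_m -> 'cV[R]_m -> 'cV[R]_m) : bilin R m :=
  linfun (fun x => linfun (f x)).

Lemma mkbilinE (R : comNzRingType) (m : nat)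
    (f : 'cV[R]_m -> 'cV[R]_m -> 'cV[R]_m) :
  (forall y, linear (f^~ y)) -> (forall x, linear (f x)) ->
  forall x y, mkbilin f x y = f x y.
Proof.
move=> linl linr.
have Er x y : linfun (f x) y = f x y.
  pose mx := GRing.isLinear.Build _ _ _ _ (f x) (linr x).
  pose g : {linear _ -> _} := HB.pack (f x) mx.
  exact: (lfunE g y).
have linF : linear (fun x => linfun (f x)).
  by move=> a x1 x2; apply/lfunP=> y; rewrite add_lfunE scale_lfunE !Er linl.
move=> x y; rewrite /mkbilin.
pose mF := GRing.isLinear.Build _ _ _ _ (fun x => linfun (f x)) linF.
pose F : {linear _ -> _} := HB.pack (fun x => linfun (f x)) mF.
by rewrite (lfunE F x) /= Er.
Qed.

Definition alternating (R : comNzRingType) (m : nat) (f : bilin R m) : Prop :=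
  forall x, f x x = 0.

(* f is in L_m(R). *)
Definition is_lie_mult (R : comNzRingType) (m : nat) (f : bilin R m) : Prop :=
  alternating f /\
  forall x y z, f x (f y z) + f y (f z x) + f z (f x y) = 0.

(* Scalar extension of f to A (x) K^m = A^m. *)
Definition base_change (K : fieldType) (A : comAlgType K) (m : nat)
    (f : bilin K m) : bilin A m :=
  mkbilin (fun x y : 'cV[A]_m =>
    \sum_i \sum_j (x i 0 * y j 0) *:
      map_mx (in_alg A) (f (delta_mx i 0) (delta_mx j 0))).

Definition is_deformation (K : fieldType) (A : comAlgType K) (m : nat)
    (I : A -> Prop) (phi0 : bilin K m) (phi : bilin A m) : Prop :=
  is_lie_mult phi /\
  forall x y k, I ((phi x y - base_change A phi0 x y) k 0).

(* s is in G_m(A) = id + M_m(I). *)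
Definition in_G (A : comNzRingType) (m : nat) (I : A -> Prop)
    (s : 'M[A]_m) : Prop :=
  forall i j, I ((s - 1%:M) i j).

Definition lie_act (A : comUnitRingType) (m : nat) (s : 'M[A]_m)
    (phi : bilin A m) : bilin A m :=
  mkbilin (fun x y => s *m phi (invmx s *m x) (invmx s *m y)).

Definition in_G_orbit (A : comUnitRingType) (m : nat) (I : A -> Prop)
    (phi' phi : bilin A m) : Prop :=
  exists2 s : 'M[A]_m, in_G I s & phi = lie_act s phi'.

Section Cochains.
Variables (K : fieldType) (m n : nat).
Implicit Type e : n.-tuple (bilin K m).

(* e is a basis of C^2(g, g) = Hom(Lambda^2 g, g), seen as the space of
   alternating bilinear maps. *)
Definition is_basis_C2 e : Prop :=
  free e /\ forall f : bilin K m, f \in <<e>>%VS <-> alternating f.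

(* The Chevalley-Eilenberg differential C^1(g, g) -> C^2(g, g) with adjoint
   coefficients, for g = (K^m, phi0). *)
Definition CE_diff (phi0 : bilin K m) (L : 'End('cV[K]_m)) : bilin K m :=
  mkbilin (fun x y => phi0 x (L y) - phi0 y (L x) - L (phi0 x y)).

Definition B2 (phi0 : bilin K m) : {vspace bilin K m} := limg (linfun (CE_diff phi0)).

Definition diff_coord (phi0 : bilin K m) e (i : 'I_n) : 'Hom('End('cV[K]_m), K^o) :=
  linfun (fun L => coord e i (CE_diff phi0 L) : K^o).

Definition diff_coord_rank (phi0 : bilin K m) e (S : {set 'I_n}) : nat :=
  \dim <<[seq diff_coord phi0 e i | i <- enum S]>>%VS.

Definition admissible (phi0 : bilin K m) e (S : {set 'I_n}) : bool :=
  minset (fun T : {set 'I_n} => diff_coord_rank phi0 e T == \dim (B2 phi0)) S.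

End Cochains.

Lemma base_changeE (K : fieldType) (A : comAlgType K) (m : nat)
    (f : bilin K m) (x y : 'cV[A]_m) :
  base_change A f x y = \sum_i \sum_j (x i 0 * y j 0) *:
    map_mx (in_alg A) (f (delta_mx i 0) (delta_mx j 0)).
Proof.
apply: mkbilinE => [z a u v|z a u v];
  rewrite scaler_sumr -big_split; apply: eq_bigr => i _;
  rewrite scaler_sumr -big_split; apply: eq_bigr => j _ /=;
  rewrite scalerA -scalerDl !mxE.
  by rewrite mulrDl mulrA.
by rewrite mulrDr mulrCA.
Qed.

Lemma base_change_pure (K : fieldType) (A : comAlgType K) (m : nat)
    (f : bilin K m) (x y : 'cV[K]_m) :
  base_change A f (map_mx (in_alg A) x) (map_mx (in_alg A) y)
  = map_mx (in_alg A) (f x y).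
Proof.
have colE (z : 'cV[K]_m) : z = \sum_i z i 0 *: delta_mx i 0.
  by rewrite {1}[z]matrix_sum_delta; apply: eq_bigr => i _; rewrite big_ord1.
rewrite base_changeE {2}[x]colE {2}[y]colE (linear_sum f) sum_lfunE raddf_sum.
apply: eq_bigr => i _.
rewrite linear_sum raddf_sum; apply: eq_bigr => j _ /=.
by rewrite linearZ_LR (linearZ_LR f) /= scale_lfunE scalerA mulrC map_mxZ rmorphM !mxE.
Qed.

(* A basis of C^2 over K stays A-linearly independent after base change, so the
   coordinates over A of a multiplication are unique. *)
Lemma base_change_free (K : fieldType) (A : comAlgType K) (m n : nat)
    (e : n.-tuple (bilin K m)) (c : 'I_n -> A) :
  free e -> \sum_i c i *: base_change A (tnth e i) = 0 -> forall i, c i = 0.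
Proof.
move=> free_e sum0 j.
pose E a b k : bilin K m :=
  mkbilin (fun x y => (x a 0 * y b 0) *: delta_mx k 0).
have EE a b k x y : E a b k x y = (x a 0 * y b 0) *: delta_mx k 0.
  apply: mkbilinE => [z t u v|z t u v]; rewrite !mxE scalerA -scalerDl.
    by rewrite mulrDl mulrA.
  by rewrite mulrDr mulrCA.
pose T (f : bilin K m) a b k := f (delta_mx a 0) (delta_mx b 0) k 0.
have fE f : f = \sum_a \sum_b \sum_k T f a b k *: E a b k.
  apply/lfunP=> x; apply/lfunP=> y.
  have colE (z : 'cV[K]_m) : z = \sum_i z i 0 *: delta_mx i 0.
    by rewrite {1}[z]matrix_sum_delta; apply: eq_bigr => i _; rewrite big_ord1.
  rewrite {1}[x]colE {1}[y]colE (linear_sum f) !sum_lfunE.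
  apply: eq_bigr => a _; rewrite !sum_lfunE linear_sum.
  apply: eq_bigr => b _; rewrite !sum_lfunE linearZ_LR (linearZ_LR f) /=.
  rewrite scale_lfunE [f _ _]colE !scaler_sumr.
  apply: eq_bigr => k _; rewrite !scale_lfunE EE !scalerA.
  by congr (_ *: _); rewrite /T mulrC [y b 0 * _]mulrC.
have coordE i : \sum_a \sum_b \sum_k T (tnth e i) a b k * coord e j (E a b k)
    = (i == j)%:R.
  have := coord_free i j free_e; rewrite -tnth_nth.
  rewrite {1}[tnth e i]fE => <-; rewrite linear_sum; apply: eq_bigr => a _.
  rewrite linear_sum; apply: eq_bigr => b _; rewrite linear_sum.
  by apply: eq_bigr => k _; rewrite linearZ.
have sumT a b k : \sum_i c i * (T (tnth e i) a b k)%:A = 0.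
  have := congr1 (fun f : bilin A m =>
    f (map_mx (in_alg A) (delta_mx a 0)) (map_mx (in_alg A) (delta_mx b 0)) k 0)
    sum0.
  rewrite !sum_lfunE summxE !zero_lfunE mxE => sum0_abk; rewrite -[RHS]sum0_abk.
  by apply: eq_bigr => i _; rewrite !scale_lfunE base_change_pure !mxE.
have -> : c j = \sum_i c i * ((i == j)%:R)%:A.
  rewrite (bigD1 j) //= eqxx scale1r mulr1 big1 ?addr0 // => i.
  by move=> /negPf ->; rewrite scale0r mulr0.
under eq_bigr => i _ do rewrite -coordE.
transitivity (\sum_i \sum_a \sum_b \sum_k
    (c i * (T (tnth e i) a b k)%:A) * (coord e j (E a b k))%:A).
  apply: eq_bigr => i _; rewrite scaler_suml mulr_sumr; apply: eq_bigr => a _.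
  rewrite scaler_suml mulr_sumr; apply: eq_bigr => b _.
  rewrite scaler_suml mulr_sumr; apply: eq_bigr => k _.
  by rewrite -mulrA -scalerAl mul1r scalerA.
rewrite exchange_big big1 //= => a _; rewrite exchange_big big1 //= => b _.
by rewrite exchange_big big1 //= => k _; rewrite -mulr_suml sumT mul0r.
Qed.

Lemma lie_actE (A : comUnitRingType) (m : nat) (s : 'M[A]_m) (phi : bilin A m)
    x y :
  lie_act s phi x y = s *m phi (invmx s *m x) (invmx s *m y).
Proof.
apply: mkbilinE => z a u v; rewrite linearP.
  by rewrite linearP add_lfunE scale_lfunE linearP.
by rewrite linearP linearP.
Qed.

Lemma CE_diffE (K : fieldType) (m : nat) (phi0 : bilin K m)
    (L : 'End('cV[K]_m)) x y :
  CE_diff phi0 L x y = phi0 x (L y) - phi0 y (L x) - L (phi0 x y).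
Proof.
apply: mkbilinE => z a u v; rewrite !linearP ?add_lfunE ?scale_lfunE ?linearP /=.
  by rewrite !scalerDr; rewrite [LHS](AC (2*2*2) ((1*3*5)*(2*4*6))).
by rewrite !scalerDr; rewrite [LHS](AC (2*2*2) ((1*3*5)*(2*4*6))).
Qed.

Lemma CE_diff_is_linear (K : fieldType) (m : nat) (phi0 : bilin K m) :
  linear (CE_diff phi0).
Proof.
move=> a L1 L2; apply/lfunP=> x; apply/lfunP=> y.
rewrite !(add_lfunE, scale_lfunE) !CE_diffE !(add_lfunE, scale_lfunE) !linearP.
by rewrite !scalerDr; rewrite [LHS](AC (2*2*2) ((1*3*5)*(2*4*6))).
Qed.

Lemma CE_diff_alternating (K : fieldType) (m : nat) (phi0 : bilin K m)
    (L : 'End('cV[K]_m)) :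
  alternating phi0 -> alternating (CE_diff phi0 L).
Proof. by move=> alt0 x; rewrite CE_diffE alt0 linear0 subrr subr0. Qed.

(* Main.v *)
(* Construct gauges s_k in G_m(A) such that the calA-coordinates of s_k * phi'
   agree with those of phi0 modulo m^(k+1).  For L with entries in m^k (k > 0)
   and phi reducing to phi0 modulo m, (1 + L) * phi = phi - dL modulo m^(k+1),
   with d the Chevalley-Eilenberg differential of phi0.  Admissibility makes the
   forms L |-> (dL)^alpha, alpha in calA, linearly independent, so L can be
   chosen to cancel the defect modulo m^(k+1).  The s_k form a Cauchy sequence;
   its limit s has no defect, because A is separated. *)
Require Import Defs.
From HB Require Import structures.
From mathcomp Require Import all_boot all_order all_algebra ring.

Set Implicit Arguments.
Unset Strict Implicit.
Unset Printing Implicit Defensive.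

Import GRing.Theory.
Local Open Scope ring_scope.

(** * Powers of an ideal, adic separatedness and units of a complete ring *)

Section IdealTheory.
Variable R : comNzRingType.
Implicit Types I J : R -> Prop.

Section Ops.
Variables (J : R -> Prop) (idJ : is_ideal J).

Lemma is_ideal0 : J 0.
Proof. by case: idJ. Qed.

Lemma is_idealD x y : J x -> J y -> J (x + y).
Proof. by case: idJ => _ + _; apply. Qed.

Lemma is_idealMl a x : J x -> J (a * x).
Proof. by case: idJ => _ _; apply. Qed.

Lemma is_idealMr a x : J x -> J (x * a).
Proof. by rewrite mulrC; apply: is_idealMl. Qed.

Lemma is_idealN x : J x -> J (- x).
Proof. by rewrite -mulN1r; apply: is_idealMl. Qed.

Lemma is_idealB x y : J x -> J y -> J (x - y).
Proof. by move=> Jx Jy; apply: is_idealD => //; apply: is_idealN. Qed.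

Lemma is_ideal_sum (T : Type) (r : seq T) (P : pred T) (F : T -> R) :
  (forall i, P i -> J (F i)) -> J (\sum_(i <- r | P i) F i).
Proof.
move=> JF; elim/big_rec: _ => [|i x Pi Jx]; first exact: is_ideal0.
by apply: is_idealD => //; apply: JF.
Qed.

Lemma is_ideal_subM x1 x2 y1 y2 :
  J (x1 - x2) -> J (y1 - y2) -> J (x1 * y1 - x2 * y2).
Proof.
move=> Jx Jy.
have -> : x1 * y1 - x2 * y2 = (x1 - x2) * y1 + x2 * (y1 - y2).
  by rewrite mulrBl mulrBr addrA subrK.
by apply: is_idealD; [apply: is_idealMr | apply: is_idealMl].
Qed.

(** The determinant is a polynomial in the entries, and congruence modulo [J] respects sums and
    products. *)
Lemma is_ideal_det n (M N : 'M[R]_n) :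
  (forall i j, J (M i j - N i j)) -> J (\det M - \det N).
Proof.
move=> JMN; rewrite /determinant -sumrB; apply: is_ideal_sum => s _.
rewrite -mulrBr; apply: is_idealMl.
elim/big_ind2: _ => // [|x1 x2 y1 y2]; first by rewrite subrr; apply: is_ideal0.
exact: is_ideal_subM.
Qed.

End Ops.

(** Concatenating lists adds their sums, and a scalar is absorbed by the second factors. *)
Lemma is_ideal_mul I J : is_ideal J -> is_ideal (ideal_mul I J).
Proof.
move=> idJ; split=> [|x y [s [IJs ->]] [t [IJt ->]]|a x [s [IJs ->]]].
- by exists [::]; rewrite big_nil.
- exists (s ++ t); rewrite big_cat; split=> // p.
  by rewrite mem_cat => /orP[/IJs | /IJt].
- exists [seq (p.1, a * p.2) | p <- s]; split=> [p|].
    by case/mapP=> q /IJs[Iq Jq] -> /=; split=> //; apply: is_idealMl.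
  by rewrite big_map mulr_sumr; apply: eq_bigr => p _; rewrite mulrCA.
Qed.

Lemma is_ideal_exp I k : is_ideal (ideal_exp I k).
Proof. by elim: k => [|k IHk] /=; [split | apply: is_ideal_mul]. Qed.

Lemma ideal_expS I k x y : I x -> ideal_exp I k y -> ideal_exp I k.+1 (x * y).
Proof.
move=> Ix Iy; exists [:: (x, y)]; rewrite big_seq1; split=> // p.
by rewrite inE => /eqP->.
Qed.

Lemma ideal_expW I k x : ideal_exp I k.+1 x -> ideal_exp I k x.
Proof.
case=> s [Is ->]; rewrite big_seq; apply: is_ideal_sum => [|p /Is[_ Ip]].
  exact: is_ideal_exp.
by apply: is_idealMl => //; apply: is_ideal_exp.
Qed.

Lemma ideal_exp_sub I k x : is_ideal I -> ideal_exp I k.+1 x -> I x.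
Proof.
move=> idI [s [Is ->]]; rewrite big_seq; apply: is_ideal_sum => // p /Is[Ip _].
exact: is_idealMr.
Qed.

Lemma ideal_exp1 I x : I x -> ideal_exp I 1 x.
Proof. by move=> Ix; rewrite -[x]mulr1; apply: ideal_expS. Qed.

Lemma ideal_exp_power I k x : I x -> ideal_exp I k (x ^+ k).
Proof.
by move=> Ix; elim: k => [|k IHk] //; rewrite exprS; apply: ideal_expS.
Qed.

(** Both [a] and 0 are limits of the constant sequence 0, and limits are unique. *)
Lemma complete_separated I a :
  adically_complete I -> (forall k, ideal_exp I k a) -> a = 0.
Proof.
move=> complI Ia; have [k|b [_ uniq_b]] := complI (fun=> 0).
  by rewrite subrr; apply: is_ideal0; apply: is_ideal_exp.
rewrite -(uniq_b a) => [|k]; last by rewrite subr0.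
by apply: uniq_b => k; rewrite subrr; apply: is_ideal0; apply: is_ideal_exp.
Qed.

End IdealTheory.

(** The geometric series converges to an inverse: its partial sums satisfy (1 - x) u_k = 1 - x^k,
    and separatedness removes the error term. *)
Lemma unit_1B (R : comUnitRingType) (I : R -> Prop) x :
  adically_complete I -> I x -> 1 - x \is a GRing.unit.
Proof.
move=> complI Ix; pose u k := \sum_(i < k) x ^+ i.
have [k|a [lim_a _]] := complI u.
  rewrite /u big_ord_recr /= addrAC subrr add0r.
  exact: ideal_exp_power.
apply/unitrPr; exists a; apply/eqP; rewrite -subr_eq0; apply/eqP.
apply: (complete_separated complI) => k; have idk := is_ideal_exp I k.
have -> : (1 - x) * a - 1 = (1 - x) * (a - u k) - x ^+ k.
  have <- : 1 - (1 - x) * u k = x ^+ k.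
    by rewrite -mulNr opprB -subrX1 addrC subrK.
  by rewrite mulrBr opprB addrA subrK.
by apply: (is_idealB idk); [apply: is_idealMl | apply: ideal_exp_power].
Qed.

(** * Matrices and values of bilinear maps modulo an ideal *)

Definition mx_in (R : comNzRingType) (J : R -> Prop) p q (M : 'M[R]_(p, q)) :=
  forall i j, J (M i j).

Section MatrixIdeal.
Variable R : comNzRingType.
Implicit Types I J : R -> Prop.

Lemma mx_inD J p q (M N : 'M_(p, q)) :
  is_ideal J -> mx_in J M -> mx_in J N -> mx_in J (M + N).
Proof. by move=> idJ JM JN i j; rewrite mxE; apply: is_idealD. Qed.

Lemma mx_inN J p q (M : 'M_(p, q)) :
  is_ideal J -> mx_in J M -> mx_in J (- M).
Proof. by move=> idJ JM i j; rewrite mxE; apply: is_idealN. Qed.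

Lemma mx_inB J p q (M N : 'M_(p, q)) :
  is_ideal J -> mx_in J M -> mx_in J N -> mx_in J (M - N).
Proof. by move=> idJ JM JN; apply: mx_inD => //; apply: mx_inN. Qed.

Lemma mx_in_mul J1 J2 J p q r (M : 'M_(p, q)) (N : 'M_(q, r)) :
    is_ideal J -> (forall x y, J1 x -> J2 y -> J (x * y)) ->
  mx_in J1 M -> mx_in J2 N -> mx_in J (M *m N).
Proof.
by move=> idJ JM JN ? i j; rewrite mxE; apply: is_ideal_sum => // k _; apply: JM.
Qed.

Lemma mx_in_mull J p q r (M : 'M_(p, q)) (N : 'M_(q, r)) :
  is_ideal J -> mx_in J N -> mx_in J (M *m N).
Proof.
move=> idJ; apply: (@mx_in_mul (fun=> True)) => // x y _.
exact: is_idealMl.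
Qed.

Lemma mx_in_mulr J p q r (M : 'M_(p, q)) (N : 'M_(q, r)) :
  is_ideal J -> mx_in J M -> mx_in J (M *m N).
Proof.
move=> idJ JM; apply: (@mx_in_mul J (fun=> True)) => // x y Jx _.
exact: is_idealMr.
Qed.

Lemma col_sum_delta m (z : 'cV[R]_m) : z = \sum_i z i 0 *: delta_mx i 0.
Proof.
by rewrite {1}[z]matrix_sum_delta; apply: eq_bigr => i _; rewrite big_ord1.
Qed.

Lemma bilin_basisE m (f : bilin R m) (x y : 'cV_m) :
  f x y = \sum_a \sum_b (x a 0 * y b 0) *: f (delta_mx a 0) (delta_mx b 0).
Proof.
rewrite {1}[x]col_sum_delta {1}[y]col_sum_delta (linear_sum f) sum_lfunE.
apply: eq_bigr => a _; rewrite linear_sum; apply: eq_bigr => b _.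
by rewrite linearZ_LR (linearZ_LR f) /= scale_lfunE scalerA mulrC.
Qed.

Lemma bilin_eqP m (f g : bilin R m) :
  (forall a b, f (delta_mx a 0) (delta_mx b 0) = g (delta_mx a 0) (delta_mx b 0)) ->
  f = g.
Proof.
move=> fg; apply/lfunP=> x; apply/lfunP=> y.
rewrite bilin_basisE [RHS]bilin_basisE.
by do 2!apply: eq_bigr => ? _; rewrite fg.
Qed.

(** The hypothesis keeps the three factors together, so that membership in [J] may come from [x],
    from [y], from [f], or from a product of two of them. *)
Lemma mx_in_bilin J m (f : bilin R m) (x y : 'cV_m) :
    is_ideal J ->
    (forall a b k, J (x a 0 * y b 0 * f (delta_mx a 0) (delta_mx b 0) k 0)) ->
  mx_in J (f x y).
Proof.
move=> idJ Jf k l; rewrite ord1 bilin_basisE summxE; apply: is_ideal_sum => // a _.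
by rewrite summxE; apply: is_ideal_sum => // b _; rewrite mxE.
Qed.

Lemma bilinDl m (f : bilin R m) x1 x2 y : f (x1 + x2) y = f x1 y + f x2 y.
Proof. by rewrite linearD add_lfunE. Qed.

Lemma bilinBl m (f : bilin R m) x1 x2 y : f (x1 - x2) y = f x1 y - f x2 y.
Proof. by rewrite linearB add_lfunE opp_lfunE. Qed.

Lemma alternating_opp m (f : bilin R m) x y :
  alternating f -> f y x = - f x y.
Proof.
move=> altf; apply/eqP; rewrite -addr_eq0; apply/eqP.
by have := altf (x + y); rewrite bilinDl !linearD /= !altf add0r addr0 addrC.
Qed.

End MatrixIdeal.

(** * The action of matrices on multiplications and the group of gauges *)

Section Action.
Variables (R : comUnitRingType) (m : nat).
Implicit Types (s t : 'M[R]_m) (f g : bilin R m) (J : R -> Prop).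

Lemma lie_act1 f : lie_act 1%:M f = f.
Proof.
by apply/lfunP=> x; apply/lfunP=> y; rewrite lie_actE invmx1 !mul1mx.
Qed.

Lemma lie_actM s t f :
    s \in unitmx -> t \in unitmx ->
  lie_act (s *m t) f = lie_act s (lie_act t f).
Proof.
move=> us ut; have ust : s *m t \in unitmx by rewrite unitmx_mul us.
have invM : invmx (s *m t) = invmx t *m invmx s.
  apply: (can_inj (mulKmx ust)).
  by rewrite mulmxV // mulmxA mulmxK // mulmxV.
by apply/lfunP=> x; apply/lfunP=> y; rewrite !lie_actE invM !mulmxA.
Qed.

Lemma lie_act_alternating s f : alternating f -> alternating (lie_act s f).
Proof. by move=> altf x; rewrite lie_actE altf mulmx0. Qed.

(** The inverses are congruent too, so the three occurrences of [s] can be exchanged for [t] one at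
    a time. This compares a gauge with the identity, and the limit gauge with its approximations. *)
Lemma lie_act_cong J s t f :
    is_ideal J -> s \in unitmx -> t \in unitmx -> mx_in J (s - t) ->
  forall x y, mx_in J ((lie_act s f - lie_act t f) x y).
Proof.
move=> idJ us ut Jst x y.
have Jinv : mx_in J (invmx s - invmx t).
  (* Resolvent identity. *)
  have -> : invmx s - invmx t = - (invmx s *m (s - t) *m invmx t).
    by rewrite mulmxBr mulmxBl mulVmx // mul1mx mulmxK // opprB.
  by apply: mx_inN => //; apply: mx_in_mulr => //; apply: mx_in_mull.
have Jf u v : mx_in J u \/ mx_in J v -> mx_in J (f u v).
  move=> Juv; apply: mx_in_bilin => // a b k; apply: is_idealMr => //.
  by case: Juv => ?; [apply: is_idealMr | apply: is_idealMl].
rewrite add_lfunE add_lfunE !opp_lfunE !lie_actE.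
set s' := invmx s; set t' := invmx t.
have -> : s *m f (s' *m x) (s' *m y) - t *m f (t' *m x) (t' *m y) =
    (s - t) *m f (s' *m x) (s' *m y)
    + t *m (f ((s' - t') *m x) (s' *m y) + f (t' *m x) ((s' - t') *m y)).
  rewrite (mulmxBl s') bilinBl (mulmxBl s') linearB /= addrA subrK mulmxBl mulmxBr.
  by rewrite addrA subrK.
apply: mx_inD => //; first exact: mx_in_mulr.
apply: mx_in_mull => //; apply: mx_inD => //; apply: Jf.
  by left; apply: mx_in_mulr.
by right; apply: mx_in_mulr.
Qed.

(** The determinant is congruent to det 1 = 1 modulo [I], hence a unit by the geometric series. *)
Lemma in_G_unit (I : R -> Prop) s :
  is_ideal I -> adically_complete I -> in_G I s -> s \in unitmx.
Proof.
move=> idI complI Gs; rewrite unitmxE -[\det s](subKr 1).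
apply: (unit_1B complI); rewrite -[1](det1 R m); apply: is_ideal_det => // i j.
by have := is_idealN idI (Gs i j); rewrite !mxE opprB.
Qed.

Lemma in_GM (I : R -> Prop) s t :
  is_ideal I -> in_G I s -> in_G I t -> in_G I (s *m t).
Proof.
move=> idI Gs Gt.
have st1 : s *m t - 1%:M = s *m (t - 1%:M) + (s - 1%:M).
  by rewrite mulmxBr mulmx1 addrA subrK.
by rewrite /in_G st1; apply: mx_inD => //; apply: mx_in_mull.
Qed.

Lemma in_G1D (I : R -> Prop) t : mx_in I t -> in_G I (1%:M + t).
Proof. by move=> It i j; rewrite addrC addKr. Qed.

End Action.

(** * Duality for finitely many linear forms *)

(** In coordinates the forms are rows. A row outside the row space of [F] is not killed by the
    cokernel matrix of [F], each column of which is a common zero of the rows of [F]; rescaling such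
    a column gives the vector. *)
Lemma separating_vector (K : fieldType) (V : vectType K) n
    (f : 'I_n -> 'Hom(V, K^o)) (S : {set 'I_n}) (g : 'Hom(V, K^o)) :
    g \notin <<[seq f i | i <- enum S]>>%VS ->
  exists2 v, g v = 1 & forall i, i \in S -> f i v = 0.
Proof.
move=> gNf; pose b := vbasis (fullv : {vspace V}).
pose rowf (h : 'Hom(V, K^o)) : 'rV[K]_(\dim (fullv : {vspace V})) := \row_j h b`_j.
(* Zero rows at the indices outside [S] keep the index type ['I_n] and leave the row space spanned
   by the forms of [S]. *)
pose F := \matrix_(i < n) (if i \in S then rowf (f i) else 0).
pose vec (w : 'cV[K]_(\dim (fullv : {vspace V}))) := \sum_j w j 0 *: b`_j.
have vecE (h : 'Hom(V, K^o)) w : h (vec w) = (rowf h *m w) 0 0.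
  by rewrite linear_sum mxE; apply: eq_bigr => j _; rewrite linearZ mxE mulrC.
have FgN0 : rowf g *m cokermx F != 0.
  rewrite -submxE; apply: contra gNf => /submxP[D gE].
  have -> : g = \sum_(i in S) D 0 i *: f i.
    apply/lfunP=> v; have /coord_vbasis -> : v \in fullv by rewrite memvf.
    rewrite !linear_sum; apply: eq_bigr => j _; rewrite !linearZ; congr (_ *: _).
    rewrite -/b /=; have -> : g b`_j = rowf g 0 j by rewrite mxE.
    rewrite gE mxE sum_lfunE [RHS]big_mkcond; apply: eq_bigr => i _.
    by rewrite scale_lfunE !mxE; case: ifP; rewrite mxE // mulr0.
  apply: rpred_sum => i Si; apply: rpredZ; apply: memv_span.
  by apply: map_f; rewrite mem_enum.
have /existsP[j gj] : [exists j, (rowf g *m cokermx F) 0 j != 0].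
  apply: contraR FgN0; rewrite negb_exists => /forallP Fg0.
  apply/eqP/matrixP=> i j; rewrite ord1 [RHS]mxE.
  by apply/eqP; move: (Fg0 j); rewrite negbK.
pose v := vec (col j (cokermx F)).
have gv : g v != 0 by rewrite vecE colE mulmxA -colE mxE.
have fv i : i \in S -> f i v = 0.
  move=> Si; rewrite vecE colE mulmxA.
  have -> : rowf (f i) = row i F by rewrite rowK Si.
  by rewrite -row_mul mulmx_coker row0 mul0mx mxE.
exists ((g v)^-1 *: v) => [|i Si]; rewrite linearZ; first exact: mulVf.
by rewrite /= fv // scaler0.
Qed.

(** * Elementary alternating maps *)

Section AlternatingBasis.
Variables (R : comNzRingType) (m : nat).

(** For a < b these form the standard basis of the alternating maps. The ring is arbitrary so that
    the maps over [K] and over [A] correspond under base change. *)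
Definition alt_elem (a b k : 'I_m) : bilin R m :=
  mkbilin (fun x y => (x a 0 * y b 0 - y a 0 * x b 0) *: delta_mx k 0).

Lemma alt_elemE a b k x y :
  alt_elem a b k x y = (x a 0 * y b 0 - y a 0 * x b 0) *: delta_mx k 0.
Proof.
apply: mkbilinE => z t u v; rewrite !mxE scalerA -scalerDl;
  by congr (_ *: _); ring.
Qed.

Lemma alt_elem_alternating a b k : alternating (alt_elem a b k).
Proof. by move=> x; rewrite alt_elemE subrr scale0r. Qed.

Lemma sum_upper_triangle (V : zmodType) (G : 'I_m -> 'I_m -> V) :
    (forall a, G a a = 0) ->
  \sum_a \sum_b G a b = \sum_(a < m) \sum_(b < m | (a < b)%N) (G a b + G b a).
Proof.
move=> G0; under [RHS]eq_bigr do rewrite big_split /=.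
rewrite big_split /= [X in _ = _ + X](exchange_big_dep predT) //= -big_split /=.
apply: eq_bigr => a _; rewrite (bigID (fun b : 'I_m => a < b)%N) /=; congr (_ + _).
rewrite (bigD1 a) ?ltnn //= G0 add0r; apply: eq_bigl => b.
by rewrite -leqNgt ltn_neqAle andbC.
Qed.

(** The diagonal terms of the expansion vanish, and the terms at (a, b) and (b, a) have opposite
    values of [f], so they merge into one elementary map. *)
Lemma alternating_sum_elem (f : bilin R m) : alternating f ->
  f = \sum_(a < m) \sum_(b < m | (a < b)%N) \sum_k
        f (delta_mx a 0) (delta_mx b 0) k 0 *: alt_elem a b k.
Proof.
move=> altf; apply/lfunP=> x; apply/lfunP=> y.
rewrite bilin_basisE sum_upper_triangle => [|a]; last by rewrite altf scaler0.
rewrite !sum_lfunE; apply: eq_bigr => a _; rewrite !sum_lfunE.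
apply: eq_bigr => b _; rewrite !sum_lfunE.
rewrite (alternating_opp (delta_mx a 0)) // scalerN -scalerBl.
set v := f _ _; rewrite {1}[v]matrix_sum_delta scaler_sumr.
apply: eq_bigr => k _; rewrite big_ord1 !scale_lfunE alt_elemE !scalerA.
by congr (_ *: _); ring.
Qed.

End AlternatingBasis.

(** * Base change of multiplications, endomorphisms and coboundaries *)

Section BaseChange.
Variables (K : fieldType) (A : comAlgType K) (m : nat).
Implicit Type f : bilin K m.

Lemma base_change_delta f a b :
  base_change A f (delta_mx a 0) (delta_mx b 0)
  = map_mx (in_alg A) (f (delta_mx a 0) (delta_mx b 0)).
Proof. by rewrite -base_change_pure !map_delta_mx. Qed.

Lemma base_change_sum (I : Type) (r : seq I) (P : pred I) (c : I -> K)
    (F : I -> bilin K m) :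
  base_change A (\sum_(i <- r | P i) c i *: F i)
  = \sum_(i <- r | P i) (c i)%:A *: base_change A (F i).
Proof.
apply: bilin_eqP => a b; rewrite base_change_delta !sum_lfunE raddf_sum.
apply: eq_bigr => i _.
by rewrite !scale_lfunE base_change_delta /= map_mxZ.
Qed.

Lemma base_change_alt_elem (a b k : 'I_m) :
  base_change A (alt_elem K a b k) = alt_elem A a b k.
Proof.
apply: bilin_eqP => p q; rewrite base_change_delta !alt_elemE map_mxZ.
by rewrite map_delta_mx rmorphB !rmorphM !mxE !rmorph_nat.
Qed.

Definition mx_of_end (L : 'End('cV[K]_m)) : 'M[K]_m :=
  \matrix_(i, j) L (delta_mx j 0) i 0.

Lemma mx_of_endE L x : mx_of_end L *m x = L x.
Proof.
rewrite {2}[x]col_sum_delta linear_sum; apply/colP=> i; rewrite mxE summxE.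
by apply: eq_bigr => j _; rewrite linearZ !mxE mulrC.
Qed.

(** Alternation turns -f(y, Lx) into f(Lx, y), which gives the shape of the first-order term of the
    action. Basis vectors suffice, and they come from [K]. *)
Lemma base_change_CE_diff (f : bilin K m) L a b :
    alternating f ->
  let M := map_mx (in_alg A) (mx_of_end L) in
  let x := delta_mx a 0 in let y := delta_mx b 0 in
  base_change A (CE_diff f L) x y
  = base_change A f (M *m x) y + base_change A f x (M *m y)
    - M *m base_change A f x y.
Proof.
move=> altf M x y; rewrite /M {M} base_change_delta CE_diffE.
rewrite (alternating_opp (L _) (delta_mx b 0)) // opprK.
rewrite -[x](map_delta_mx (in_alg A)) -[y](map_delta_mx (in_alg A)).
rewrite -!map_mxM !base_change_pure -map_mxM !mx_of_endE.
by rewrite raddfB raddfD /= [X in X - _]addrC.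
Qed.

End BaseChange.

(** * Coordinates over [A] with respect to a basis over [K] *)

Section Coordinates.
Variables (K : fieldType) (A : comAlgType K) (m n : nat).
Variables (e : n.-tuple (bilin K m)) (basis_e : is_basis_C2 e).

(** On alternating maps this is the [A]-linear extension of [coord e i], computed through the
    elementary maps. The formula makes sense, and is linear, on all bilinear maps. *)
Definition base_coord (i : 'I_n) (f : bilin A m) : A :=
  \sum_(a < m) \sum_(b < m | (a < b)%N) \sum_k
    f (delta_mx a 0) (delta_mx b 0) k 0 * (coord e i (alt_elem K a b k))%:A.

Lemma base_coord_is_linear i : linear_for *%R (base_coord i).
Proof.
move=> c f g; rewrite /base_coord.
rewrite mulr_sumr -big_split; apply: eq_bigr => a _.
rewrite mulr_sumr -big_split; apply: eq_bigr => b _.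
rewrite mulr_sumr -big_split; apply: eq_bigr => k _ /=.
by rewrite !(add_lfunE, scale_lfunE) !mxE mulrDl mulrA.
Qed.

HB.instance Definition _ i :=
  GRing.isLinear.Build A (bilin A m) A *%R (base_coord i) (base_coord_is_linear i).

(* Over a comUnitAlgType the canonical linear structure of base_coord is found
   only after a very long unification; these instances of it rewrite at once. *)
Lemma base_coordD i f g : base_coord i (f + g) = base_coord i f + base_coord i g.
Proof. exact: linearD. Qed.

Lemma base_coordB i f g : base_coord i (f - g) = base_coord i f - base_coord i g.
Proof. exact: linearB. Qed.

Lemma base_coordZ_sum i (T : Type) (r : seq T) (P : pred T) (c : T -> A) F :
  base_coord i (\sum_(j <- r | P j) c j *: F j)
  = \sum_(j <- r | P j) c j * base_coord i (F j).
Proof. by rewrite linear_sum; apply: eq_bigr => j _; rewrite linearZ. Qed.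

Lemma base_coord_base_change i (f : bilin K m) :
  alternating f -> base_coord i (base_change A f) = (coord e i f)%:A.
Proof.
move=> altf; rewrite {2}[f]alternating_sum_elem // linear_sum scaler_suml.
apply: eq_bigr => a _; rewrite linear_sum scaler_suml.
apply: eq_bigr => b _; rewrite linear_sum scaler_suml.
apply: eq_bigr => k _; rewrite linearZ base_change_delta mxE.
by rewrite /= -scalerAl mul1r scalerA.
Qed.

(** Each elementary map is a [K]-combination of [e]; substituting these combinations into the
    expansion of [f] and exchanging sums gives the coordinates. *)
Lemma base_coord_sum (f : bilin A m) :
  alternating f -> f = \sum_i base_coord i f *: base_change A (tnth e i).
Proof.
move=> altf; under eq_bigr => i _ do rewrite scaler_suml.
rewrite exchange_big {1}[f]alternating_sum_elem //=; apply: eq_bigr => a _.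
under [RHS]eq_bigr => i _ do rewrite scaler_suml.
rewrite [RHS]exchange_big /=; apply: eq_bigr => b _.
under [RHS]eq_bigr => i _ do rewrite scaler_suml.
rewrite [RHS]exchange_big /=; apply: eq_bigr => k _.
have /coord_span eE : alt_elem K a b k \in <<e>>%VS.
  by apply/basis_e.2; apply: alt_elem_alternating.
rewrite -base_change_alt_elem {1}eE base_change_sum scaler_sumr.
by apply: eq_bigr => i _; rewrite scalerA (tnth_nth 0).
Qed.

Lemma base_coord_in (J : A -> Prop) i (f : bilin A m) :
    is_ideal J ->
    (forall a b, mx_in J (f (delta_mx a 0) (delta_mx b 0))) ->
  J (base_coord i f).
Proof.
move=> idJ Jf; do 3!apply: is_ideal_sum => // ? _.
by apply: is_idealMr => //; apply: Jf.
Qed.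

End Coordinates.

(** * Coordinates of the differential and admissible sets *)

Section DiffCoord.
Variables (K : fieldType) (m n : nat) (phi0 : bilin K m).
Variable e : n.-tuple (bilin K m).

Lemma diff_coordE i L : diff_coord phi0 e i L = coord e i (CE_diff phi0 L).
Proof.
have linF : linear (fun L => coord e i (CE_diff phi0 L) : K^o).
  by move=> c L1 L2; rewrite CE_diff_is_linear linearP.
pose mF := GRing.isLinear.Build _ _ _ _ _ linF.
pose F : {linear _ -> _} := HB.pack (fun L => coord e i (CE_diff phi0 L) : K^o) mF.
exact: (lfunE F L).
Qed.

(* By minimality no form indexed by an admissible set is a combination of the
   others, so these forms have a dual family. *)
Lemma admissible_dual (S : {set 'I_n}) : admissible phi0 e S ->
  exists L : 'I_n -> 'End('cV[K]_m), forall i j, i \in S -> j \in S ->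
    coord e i (CE_diff phi0 (L j)) = (i == j)%:R.
Proof.
move=> admS; suff /fin_all_exists[L LP] : forall j, exists L, j \in S ->
    forall i, i \in S -> coord e i (CE_diff phi0 L) = (i == j)%:R.
  by exists L => i j Si Sj; apply: LP.
(* Nothing is required for an index outside [S], where 0 is a default. *)
move=> j; case: (boolP (j \in S)) => [Sj|]; last by exists 0.
have indep_j : diff_coord phi0 e j \notin
    <<[seq diff_coord phi0 e i | i <- enum (S :\ j)]>>%VS.
  apply/negP=> dep_j; have /minsetP[/eqP rkS minS] := admS.
  have /minS/(_ (subD1set S j))/setP/(_ j) :
      diff_coord_rank phi0 e (S :\ j) == \dim (B2 phi0).
    rewrite -rkS /diff_coord_rank; apply/eqP; congr (\dim _).
    apply/eqP; rewrite eqEsubv; apply/andP; split; apply/span_subvP=> f.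
      case/mapP=> i; rewrite mem_enum => /setD1P[_ Si] ->.
      by apply: memv_span; apply: map_f; rewrite mem_enum.
    case/mapP=> i; rewrite mem_enum => Si ->.
    have [-> // | ij] := eqVneq i j.
    by apply: memv_span; apply: map_f; rewrite mem_enum !inE ij.
  by rewrite !inE eqxx Sj.
have [L Lj L0] := separating_vector indep_j.
exists L => _ i Si; rewrite -diff_coordE.
by have [-> // | ij] := eqVneq i j; apply: L0; rewrite !inE ij.
Qed.

End DiffCoord.

(** * First-order effect of a gauge; [I], [J], [J'] stand for m, m^k, m^(k+1) with k > 0 *)

Section Gauge.
Variables (A : comUnitRingType) (m : nat) (I J J' : A -> Prop).
Hypotheses (idI : is_ideal I) (idJ : is_ideal J) (idJ' : is_ideal J').
Hypotheses (subJI : forall x, J x -> I x).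
Hypothesis mulIJ : forall x y, I x -> J y -> J' (x * y).

(* Comparing both sides of [psi (s x) (s y) = s (phi x y)], where psi is
   [lie_act s phi], avoids expanding the inverse of s. *)
Lemma lie_act_first_order (phi0 phi : bilin A m) (t : 'M_m) (x y : 'cV_m) :
    1%:M + t \in unitmx -> mx_in J t ->
    (forall x y, mx_in I ((phi - phi0) x y)) ->
  mx_in J' (lie_act (1%:M + t) phi x y - phi x y
    + (phi0 (t *m x) y + phi0 x (t *m y) - t *m phi0 x y)).
Proof.
set s := 1%:M + t => us Jt Iphi; pose psi := lie_act s phi.
have Jtz (z : 'cV_m) : mx_in J (t *m z) by apply: mx_in_mulr.
have psis : psi (s *m x) (s *m y) = s *m phi x y by rewrite lie_actE !mulKmx.
(* The transformed map still reduces to [phi0], since [1%:M + t] is the identity modulo [I]. *)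
have Ipsi u v : mx_in I ((psi - phi0) u v).
  have -> : (psi - phi0) u v
      = (lie_act s phi - lie_act 1%:M phi) u v + (phi - phi0) u v.
    by rewrite lie_act1 !(add_lfunE, opp_lfunE) addrA subrK.
  apply: mx_inD => //.
  apply: lie_act_cong => //; first exact: unitmx1.
  by rewrite /s addrC addKr => i j; apply: subJI.
have psixy : psi x y = phi x y + t *m phi x y - psi (t *m x) y - psi x (t *m y)
                       - psi (t *m x) (t *m y).
  have := psis; rewrite !mulmxDl !mul1mx bilinDl !linearD /= => <-.
  by apply/colP=> i; rewrite !mxE; ring.
(* Each term on the right gains a factor: in the first three an element of [J] meets a difference
   with values in [I], and the last is quadratic in [t]. *)
have -> : lie_act s phi x y - phi x y
      + (phi0 (t *m x) y + phi0 x (t *m y) - t *m phi0 x y)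
    = t *m (phi - phi0) x y - (psi - phi0) (t *m x) y
      - (psi - phi0) x (t *m y) - psi (t *m x) (t *m y).
  rewrite -/psi psixy !(add_lfunE, opp_lfunE) mulmxBr.
  set p1 := phi x y; set p2 := psi (t *m x) y.
  set p3 := psi x _; set p4 := psi _ _.
  set q1 := phi0 _ y; set q2 := phi0 x _; set q3 := t *m phi0 x y; set q4 := t *m _.
  by apply/colP=> i; rewrite !mxE; ring.
have JJ' u v : mx_in J (u : 'cV[A]_m) -> mx_in J v -> mx_in J' (psi u v).
  move=> Ju Jv; apply: mx_in_bilin => // a b k; apply: is_idealMr => //.
  by apply: mulIJ => //; apply: subJI.
have IJl u v : mx_in J u -> mx_in J' ((psi - phi0) u v).
  move=> Ju; apply: mx_in_bilin => // a b k.
  rewrite -mulrA mulrC -mulrA; apply: is_idealMl => //.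
  by apply: mulIJ; first exact: Ipsi.
have IJr u v : mx_in J v -> mx_in J' ((psi - phi0) u v).
  move=> Jv; apply: mx_in_bilin => // a b k.
  rewrite -mulrA; apply: is_idealMl => //; rewrite mulrC.
  by apply: mulIJ; first exact: Ipsi.
do 3?[apply: mx_inB => //]; auto.
apply: (@mx_in_mul _ J I) => // u v Ju Iv; rewrite mulrC; exact: mulIJ.
Qed.

End Gauge.

(** * One correction step *)

Section GaugeStep.
Variables (K : fieldType) (A : comUnitAlgType K) (m n : nat).
Variables (phi0 : bilin K m) (e : n.-tuple (bilin K m)) (S : {set 'I_n}).
Variable L : 'I_n -> 'End('cV[K]_m).
Hypothesis alt_phi0 : alternating phi0.
Hypothesis dualL : forall i j, i \in S -> j \in S ->
  coord e i (CE_diff phi0 (L j)) = (i == j)%:R.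

Definition gauge_defect (i : 'I_n) (phi : bilin A m) : A :=
  base_coord e i phi - (coord e i phi0)%:A.

(** As the family [L] is dual to the forms of [S], the coboundary of this matrix has the defects of
    [phi] as its coordinates on [S]. The gauge 1 + t subtracts that coboundary to first order, hence
    the plus sign. *)
Definition gauge_mx (phi : bilin A m) : 'M[A]_m :=
  \sum_(j in S) gauge_defect j phi *: map_mx (in_alg A) (mx_of_end (L j)).

Lemma gauge_mx_in (J : A -> Prop) phi :
    is_ideal J -> (forall i, i \in S -> J (gauge_defect i phi)) ->
  mx_in J (gauge_mx phi).
Proof.
move=> idJ Jphi a b; rewrite summxE; apply: is_ideal_sum => // j Sj.
by rewrite !mxE; apply: is_idealMr => //; apply: Jphi.
Qed.

Lemma gauge_defect_in (J : A -> Prop) i (phi psi : bilin A m) :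
    is_ideal J -> (forall x y, mx_in J ((phi - psi) x y)) ->
  J (gauge_defect i phi - gauge_defect i psi).
Proof.
move=> idJ Jphi; have -> : gauge_defect i phi - gauge_defect i psi
    = base_coord e i (phi - psi).
  by rewrite base_coordB /gauge_defect opprB addrA subrK.
by apply: base_coord_in.
Qed.

(** The [A]-combination of base-changed coboundaries plays the role of dt over [A]; both sides are
    linear in the matrix. *)
Lemma gauge_mx_CE_diff phi a b :
  let x := delta_mx a 0 in let y := delta_mx b 0 in let t := gauge_mx phi in
  (\sum_(j in S) gauge_defect j phi *: base_change A (CE_diff phi0 (L j))) x y
  = base_change A phi0 (t *m x) y + base_change A phi0 x (t *m y)
    - t *m base_change A phi0 x y.
Proof.
move=> x y t; rewrite !sum_lfunE !mulmx_suml (linear_sum (base_change A phi0)).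
rewrite linear_sum sum_lfunE -big_split -sumrB; apply: eq_bigr => j Sj.
rewrite !scale_lfunE base_change_CE_diff // -!scalemxAl.
by rewrite (linearZ_LR (base_change A phi0)) linearZ scale_lfunE scalerBr scalerDr.
Qed.

Lemma gauge_step (I J J' : A -> Prop) phi :
    is_ideal I -> is_ideal J -> is_ideal J' ->
    (forall x, J x -> I x) -> (forall x y, I x -> J y -> J' (x * y)) ->
    (forall x y, mx_in I ((phi - base_change A phi0) x y)) ->
    1%:M + gauge_mx phi \in unitmx ->
    (forall i, i \in S -> J (gauge_defect i phi)) ->
  forall i, i \in S -> J' (gauge_defect i (lie_act (1%:M + gauge_mx phi) phi)).
Proof.
move=> idI idJ idJ' subJI mulIJ Iphi us Jphi i Si.
set psi := lie_act _ _.
pose D := \sum_(j in S) gauge_defect j phi *: base_change A (CE_diff phi0 (L j)).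
(* By duality the coordinate of [D] at [i] is the old defect, so the new defect is the coordinate of
   the first-order error alone. *)
have -> : gauge_defect i psi = base_coord e i (psi - phi + D).
  have -> : base_coord e i (psi - phi + D) = base_coord e i psi
      - base_coord e i phi + base_coord e i D by rewrite base_coordD base_coordB.
  suff -> : base_coord e i D = gauge_defect i phi.
    by rewrite /gauge_defect addrA subrK.
  rewrite base_coordZ_sum (bigD1 i) //= base_coord_base_change; last first.
    exact: CE_diff_alternating.
  rewrite dualL // eqxx scale1r mulr1 big1 ?addr0 // => j /andP[Sj ji].
  rewrite base_coord_base_change; last exact: CE_diff_alternating.
  by rewrite dualL // eq_sym (negPf ji) scale0r; apply: mulr0.
apply: base_coord_in => // a b.
rewrite !(add_lfunE, opp_lfunE) gauge_mx_CE_diff.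
by apply: (@lie_act_first_order _ _ I J) => //; apply: gauge_mx_in.
Qed.

End GaugeStep.

(** * Limits of gauges and the normalised deformation *)

Section Limit.
Variables (R : comUnitRingType) (m : nat) (I : R -> Prop).
Hypothesis complI : adically_complete I.

Lemma mx_limit (u : nat -> 'M[R]_m) :
    (forall k, mx_in (ideal_exp I k) (u k.+1 - u k)) ->
  exists s : 'M[R]_m, forall k, mx_in (ideal_exp I k) (s - u k).
Proof.
move=> cau; suff /fin_all_exists[s lim_s] : forall ij : 'I_m * 'I_m,
    exists a, forall k, ideal_exp I k (a - u k ij.1 ij.2).
  exists (\matrix_(i, j) s (i, j)) => k i j; rewrite !mxE.
  exact: lim_s.
case=> i j; have [k|a [lim_a _]] := complI (u := fun k => u k i j).
  by have := cau k i j; rewrite !mxE.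
by exists a.
Qed.

End Limit.

Theorem corollary2p2
  (K : closedFieldType) (charK0 : [pchar K] =i pred0)
  (A : comUnitAlgType K) (mA : A -> Prop)
  (noethA : is_noetherian A)
  (localA : is_local mA)
  (residueA : residue_field_is_base mA)
  (completeA : adically_complete mA)
  (m : nat) (phi0 : bilin K m) (lie_phi0 : is_lie_mult phi0)
  (n : nat) (e : n.-tuple (bilin K m)) (basis_e : is_basis_C2 e)
  (calA : {set 'I_n}) (adm_calA : admissible phi0 e calA)
  (phi' : bilin A m) (def_phi' : is_deformation mA phi0 phi') :
  exists2 phi : bilin A m, in_G_orbit mA phi' phi &
    exists c : 'I_n -> A,
      phi = \sum_i c i *: base_change A (tnth e i) /\
      forall i, i \in calA -> c i = (coord e i phi0)%:A.
Proof.
have [[idI _ _] _] := localA; have [alt0 _] := lie_phi0.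
have [[alt' _] Idef] := def_phi'; have [L dualL] := admissible_dual adm_calA.
have idk := is_ideal_exp mA.
(* The correction is computed from the map already transformed by [s], so it multiplies [s] on the
   left. *)
pose step s := (1%:M + gauge_mx phi0 e calA L (lie_act s phi')) *m s.
pose u k := iter k step 1%:M.
have Iphi x y : mx_in mA ((phi' - base_change A phi0) x y).
  by move=> a b; rewrite ord1 !(add_lfunE, opp_lfunE); apply: Idef.
have G1 : in_G mA (1%:M : 'M_m).
  by move=> i j; rewrite subrr mxE; apply: is_ideal0.
have Gact s : in_G mA s ->
    forall x y, mx_in mA ((lie_act s phi' - base_change A phi0) x y).
  move=> Gs x y; have -> : (lie_act s phi' - base_change A phi0) x y
      = (lie_act s phi' - lie_act 1%:M phi') x y + (phi' - base_change A phi0) x y.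
    by rewrite lie_act1 !(add_lfunE, opp_lfunE) addrA subrK.
  apply: mx_inD => //; apply: lie_act_cong => //; last exact: unitmx1.
  exact: in_G_unit completeA Gs.
(* The exponent starts at 1: for the identity gauge the defect lies in [mA] because [phi'] reduces
   to [phi0]. *)
have uP k : in_G mA (u k) /\ forall i, i \in calA ->
    ideal_exp mA k.+1 (gauge_defect phi0 e i (lie_act (u k) phi')).
  elim: k => [|k [Gu defu]].
    split=> // i _; rewrite lie_act1; apply: ideal_exp1.
    have -> : gauge_defect phi0 e i phi'
        = gauge_defect phi0 e i phi' - gauge_defect phi0 e i (base_change A phi0).
      by rewrite {3}/gauge_defect base_coord_base_change // subrr subr0.
    exact: gauge_defect_in.
  have Gs : in_G mA (1%:M + gauge_mx phi0 e calA L (lie_act (u k) phi')).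
    apply: in_G1D; apply: gauge_mx_in => // i Si.
    by apply: (ideal_exp_sub idI (k := k)); apply: defu.
  split=> [|i Si]; first exact: in_GM.
  have us := in_G_unit idI completeA Gs; have uu := in_G_unit idI completeA Gu.
  rewrite /u iterS -/(u k) lie_actM //.
  apply: (@gauge_step _ _ _ _ _ _ _ _ alt0 dualL mA (ideal_exp mA k.+1)) => //.
  - by move=> x; apply: ideal_exp_sub.
  - by move=> x y; apply: ideal_expS.
  - exact: Gact.
have [k|s lim_s] := mx_limit completeA (u := u).
  (* The increment has entries in the power k + 1, more than the Cauchy condition asks. *)
  have -> : u k.+1 - u k = gauge_mx phi0 e calA L (lie_act (u k) phi') *m u k.
    by rewrite /u iterS /step mulmxDl mul1mx addrC addKr.
  apply: mx_in_mulr => //; apply: gauge_mx_in => // i Si.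
  by apply: ideal_expW; have [_] := uP k; apply.
have Gs : in_G mA s.
  (* Index 1 is chosen because the power of exponent 0 is the whole ring and would give no
     information on [s - u 0]. *)
  have -> : in_G mA s = mx_in mA ((s - u 1%N) + (u 1%N - 1%:M)).
    by rewrite addrA subrK.
  apply: mx_inD => //; last exact: (uP 1%N).1.
  by move=> i j; apply: (ideal_exp_sub idI (k := 0)); apply: lim_s.
exists (lie_act s phi'); first by exists s.
exists (fun i => base_coord e i (lie_act s phi')); split=> [|i Si].
  exact/base_coord_sum/lie_act_alternating.
apply/eqP; rewrite -subr_eq0; apply/eqP.
apply: (complete_separated completeA) => k.
rewrite -/(gauge_defect phi0 e i (lie_act s phi')).
(* The limit defect differs from the k-th one by an element of the k-th power, which also contains
   the k-th defect; so it lies in every power. *)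
rewrite -[gauge_defect _ _ _ _](subrK (gauge_defect phi0 e i (lie_act (u k) phi'))).
apply: is_idealD => //; last by apply: ideal_expW; apply: (uP k).2.
apply: gauge_defect_in => //; apply: lie_act_cong => //.
  exact: in_G_unit completeA Gs.
exact: in_G_unit completeA (uP k).1.
Qed.
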